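(* Let $A,B$ be two subsets of a Banach space $X$. If $A$ is strongly finitely representable in $B$, then $A$ is finitely representable in $B$.
   Context: A convex polyhedron in a Banach space is the convex hull $H$ of finitely many points; its vertex set $\mathrm{vert}(H)$ is its (finite) set of extreme points. For non-negative integers $n,m$, an $(n,m)$-polyhedron is a convex polyhedron $H$ whose affine hull $\mathrm{aff}(H)$ has dimension $n$ and which has exactly $n+m+1$ vertices. An $n$-simplex is the convex hull of $n+1$ affinely independent points (its vertices). For a Banach space $Y$ with closed unit ball $B_Y$, the Hausdorff distance of nonempty bounded sets $C,D\subset Y$ is $d_{\mathfrak H}(C,D)=\inf\{r>0: C\subset D+rB_Y,\ D\subset C+rB_Y\}$. Let $X,Y$ be Banach spaces, $A\subset X$, $B\subset Y$. Strong finite representability: given $\varepsilon>0$, $A$ is $\varepsilon$-strongly finitely representable in $B$ if for every pair $n,m$ of non-negative integers and every $(n,m)$-polyhedron $H\subset X$ with $\mathrm{vert}(H)\subset A$, there exist an $(n,m)$-polyhedron $H'\subset Y$ with $\mathrm{vert}(H')\subset B$ and an affine isomorphism $T:\mathrm{aff}(H)\to\mathrm{aff}(H')$ such that $(1-\varepsilon)\|x-y\|\le\|Tx-Ty\|\le(1+\varepsilon)\|x-y\|$ for all $x,y\in\mathrm{aff}(H)$ and $d_{\mathfrak H}(\mathrm{vert}(T(H)),\mathrm{vert}(H'))<\varepsilon$. $A$ is strongly finitely representable in $B$ if this holds for all $\varepsilon>0$. Finite representability: given $\varepsilon>0$, $A$ is $\varepsilon$-finitely representable in $B$ if for all $n\in\mathbb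 N$ and every $n$-simplex $S_n=\mathrm{co}(x_0,\dots,x_n)$ with vertices $x_0,\dots,x_n\in A$, there exist an $n$-simplex $S_n'=\mathrm{co}(y_0,\dots,y_n)$ with vertices $y_0,\dots,y_n\in B$ and an affine isomorphism $T:\mathrm{aff}(S_n)\to\mathrm{aff}(S_n')$ with $T(\{x_0,\dots,x_n\})=\{y_0,\dots,y_n\}$ (equivalently $T(S_n)=S_n'$) and $(1-\varepsilon)\|x-y\|\le\|Tx-Ty\|\le(1+\varepsilon)\|x-y\|$ for all $x,y\in\mathrm{aff}(S_n)$. $A$ is finitely representable in $B$ if this holds for all $\varepsilon>0$. *)

(* Defs.v *)
From HB Require Import structures.
From mathcomp Require Export all_boot all_order all_algebra.
From mathcomp Require Export all_classical all_reals all_analysis.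
Export Order.TTheory GRing.Theory Num.Theory.
Export numFieldNormedType.Exports.

Set Implicit Arguments.
Unset Strict Implicit.
Unset Printing Implicit Defensive.

Local Open Scope classical_set_scope.
Local Open Scope card_scope.
Local Open Scope ring_scope.

Section AffineGeometry.
Context {R : realType}.
Implicit Types V W : lmodType R.

Definition convex_hull {V} (A : set V) : set V := smallest (@convex_set R V) A.

(* Closure under binary affine combinations implies closure under all finite
   ones, since R is infinite. The empty set is affine. *)
Definition affine_set {V} (L : set V) : Prop :=
  forall (t : R) x y, L x -> L y -> L (t *: x + (1 - t) *: y).

Definition affine_hull {V} (A : set V) : set V := smallest affine_set A.

Definition affinely_independent {V} (n : nat) (x : 'I_n -> V) : Prop :=
  forall c : 'I_n -> R, \sum_(i < n) c i = 0 -> \sum_(i < n) c i *: x i = 0 ->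
    forall i, c i = 0.

Definition has_affine_dim {V} (L : set V) (n : nat) : Prop :=
  exists2 x : 'I_n.+1 -> V, affinely_independent x & L = affine_hull (range x).

Definition extreme_points {V} (H : set V) : set V :=
  [set x | H x /\ forall (t : R) y z, 0 < t < 1 -> H y -> H z ->
    x = t *: y + (1 - t) *: z -> y = x /\ z = x].

Definition convex_polyhedron {V} (H : set V) : Prop :=
  exists2 F : set V, finite_set F & H = convex_hull F.

Definition nm_polyhedron {V} (n m : nat) (H : set V) : Prop :=
  [/\ convex_polyhedron H, has_affine_dim (affine_hull H) n
    & extreme_points H #= `I_(n + m + 1)].

(* [T] is a total function, but only its values on [L] matter. *)
Definition affine_isomorphism {V W} (L : set V) (L' : set W) (T : V -> W) : Prop :=
  (forall (t : R) x y, L x -> L y ->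
     T (t *: x + (1 - t) *: y) = t *: T x + (1 - t) *: T y)
  /\ set_bij L L' T.

End AffineGeometry.

Section FiniteRepresentability.
Context {R : realType}.
Implicit Types X Y : normedModType R.

Definition closed_unit_ball Y : set Y := [set b | `|b| <= 1].

(* Meaningful for nonempty bounded sets: [inf] is a real number,
   with [inf set0 = 0]. *)
Definition hausdorff_distance {Y} (C D : set Y) : R :=
  inf [set r : R | [/\ 0 < r,
         C `<=` [set d + r *: b | d in D & b in @closed_unit_ball Y]
       & D `<=` [set c + r *: b | c in C & b in @closed_unit_ball Y]]].

Definition almost_isometric_on {X Y} (eps : R) (L : set X) (T : X -> Y) : Prop :=
  forall x y, L x -> L y ->
    (1 - eps) * `|x - y| <= `|T x - T y| <= (1 + eps) * `|x - y|.

Definition eps_strongly_finitely_representable {X Y} (eps : R)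
    (A : set X) (B : set Y) : Prop :=
  forall (n m : nat) (H : set X),
    nm_polyhedron n m H -> extreme_points H `<=` A ->
    exists (H' : set Y) (T : X -> Y),
      [/\ nm_polyhedron n m H',
          extreme_points H' `<=` B,
          affine_isomorphism (affine_hull H) (affine_hull H') T,
          almost_isometric_on eps (affine_hull H) T
        & hausdorff_distance (extreme_points (T @` H)) (extreme_points H') < eps].

Definition strongly_finitely_representable {X Y} (A : set X) (B : set Y) : Prop :=
  forall eps : R, 0 < eps -> eps_strongly_finitely_representable eps A B.

Definition eps_finitely_representable {X Y} (eps : R)
    (A : set X) (B : set Y) : Prop :=
  forall (n : nat) (x : 'I_n.+1 -> X),
    affinely_independent x -> range x `<=` A ->
    exists (y : 'I_n.+1 -> Y) (T : X -> Y),
      let S := convex_hull (range x) in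
      let S' := convex_hull (range y) in
      [/\ affinely_independent y,
          range y `<=` B,
          affine_isomorphism (affine_hull S) (affine_hull S') T,
          T @` range x = range y
        & almost_isometric_on eps (affine_hull S) T].

Definition finitely_representable {X Y} (A : set X) (B : set Y) : Prop :=
  forall eps : R, 0 < eps -> eps_finitely_representable eps A B.

End FiniteRepresentability.

(* Main.v *)
Require Import Defs.
From mathcomp Require Import lra.

(** A simplex with vertices [x i] in [A] is a polyhedron with the least
    possible number of vertices, so strong finite representability with a
    parameter [d] yields an almost isometry [T] of its affine hull and points
    [y i] of [B] with [`|T (x i) - y i| < d].  The points [T (x i)] need not lie
    in [B]; what has to be shown is that moving them to the [y i] is harmless
    when [d] is small.

    The reason is quantitative affine independence: by compactness of the unit
    sphere of a finite-dimensional space there is a constant [K], depending only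
    on [x], with [\sum_i `|c i| <= K * `|\sum_i c i *: x i|] whenever
    [\sum_i c i = 0] ([coefficients_bound]).  Hence replacing [T (x i)] by [y i]
    changes [\sum_i c i *: T (x i)] by at most [d * K * `|\sum_i c i *: x i|],
    and the correspondence between [\sum_i c i *: x i] and [\sum_i c i *: y i]
    is almost isometric with parameter [d * (1 + K)]
    ([combination_perturbation]).  If this parameter is below [1], the [y i] are
    affinely independent; in particular they are distinct, which therefore never
    has to be arranged beforehand.  If it is also at most the prescribed
    parameter, the affine map sending [x i] to [y i] is the required
    isomorphism ([almost_isometric_extension]).

    To apply the hypothesis one identifies the extreme points of a simplex with
    its vertices ([extreme_points_simplex]) and those of its image under [T]
    with the images of the vertices ([extreme_points_image]); to use its
    conclusion one extracts nearby points from a bound on the Hausdorff distance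
    ([hausdorff_distance_lt]). *)

Set Implicit Arguments.
Unset Strict Implicit.
Unset Printing Implicit Defensive.

Local Open Scope classical_set_scope.
Local Open Scope card_scope.
Local Open Scope ring_scope.

(** * Affine combinations and affine hulls *)

Section AffineHulls.
Context {R : realType}.
Implicit Types V W : lmodType R.

Lemma sum_delta n (i : 'I_n) : \sum_(j < n) ((j == i)%:R : R) = 1.
Proof. by rewrite (bigD1 i)//= eqxx big1 ?addr0// => j /negPf ->. Qed.

Lemma sum_delta_scale V n (x : 'I_n -> V) (i : 'I_n) :
  \sum_(j < n) ((j == i)%:R : R) *: x j = x i.
Proof.
rewrite (bigD1 i)//= eqxx scale1r big1 ?addr0// => j /negPf ->.
by rewrite scale0r.
Qed.

Lemma sum_mix n (t : R) (a b : 'I_n -> R) :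
  \sum_(i < n) a i = 1 -> \sum_(i < n) b i = 1 ->
  \sum_(i < n) (t * a i + (1 - t) * b i) = 1.
Proof.
by move=> a1 b1; rewrite big_split/= -!mulr_sumr a1 b1 !mulr1 addrC subrK.
Qed.

Lemma combination_mix V n (x : 'I_n -> V) (t : R) (a b : 'I_n -> R) :
  t *: (\sum_(i < n) a i *: x i) + (1 - t) *: (\sum_(i < n) b i *: x i) =
  \sum_(i < n) (t * a i + (1 - t) * b i) *: x i.
Proof.
rewrite !scaler_sumr -big_split/=; apply: eq_bigr => i _.
by rewrite !scalerA scalerDl.
Qed.

(** Translated so that one of its points becomes the origin, an affine set is a
    linear subspace: scaling is a combination with the origin, and addition is
    twice the midpoint.  Closure under binary combinations thus gives closure
    under all finite ones, without an induction that must avoid vanishing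
    partial sums of the weights. *)
Lemma affine_set_combination V (L : set V) n (x : 'I_n -> V) (c : 'I_n -> R) :
  affine_set L -> (forall i, L (x i)) -> \sum_(i < n) c i = 1 ->
  L (\sum_(i < n) c i *: x i).
Proof.
case: n x c => [|n] x c Laff Lx c1.
  by move/eqP: c1; rewrite big_ord0 eq_sym oner_eq0.
pose p := x ord0.
have Lscale t v : L (p + v) -> L (p + t *: v).
  move=> Lv; have := Laff t _ _ Lv (Lx ord0).
  by rewrite scalerDr addrAC -scalerDl [t + _]addrC subrK scale1r.
have Ladd u v : L (p + u) -> L (p + v) -> L (p + (u + v)).
  move=> Lu Lv; have := Laff 2^-1 _ _ Lu Lv.
  have -> : 1 - 2^-1 = 2^-1 :> R by rewrite [X in X - _](splitr 1) mul1r addrK.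
  rewrite -scalerDr addrACA scalerDr -mulr2n -[p *+ 2]scaler_nat scalerA.
  rewrite mulVf ?pnatr_eq0// scale1r => /(Lscale 2).
  by rewrite scalerA divff ?pnatr_eq0// scale1r.
have -> : \sum_i c i *: x i = p + \sum_i c i *: (x i - p).
  under eq_bigr do rewrite -[x _](subrK p) scalerDr addrC.
  by rewrite big_split/= -scaler_suml c1 scale1r.
apply: (big_ind (fun v => L (p + v))) => //; first by rewrite addr0; exact: Lx.
by move=> i _; apply: (Lscale); rewrite addrC subrK.
Qed.

Lemma affine_hull_affine V (A : set V) : affine_set (affine_hull A).
Proof.
by move=> t u v Au Av L [Laff AL]; apply: (Laff); [exact: Au|exact: Av].
Qed.

(** The graph of a map that is affine on [L] is an affine set of the product
    space, so this is closure of affine sets under combinations. *)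
Lemma affine_map_combination V W (L : set V) (T : V -> W) n
    (x : 'I_n -> V) (c : 'I_n -> R) :
  affine_set L ->
  (forall t u v, L u -> L v ->
     T (t *: u + (1 - t) *: v) = t *: T u + (1 - t) *: T v) ->
  (forall i, L (x i)) -> \sum_(i < n) c i = 1 ->
  T (\sum_(i < n) c i *: x i) = \sum_(i < n) c i *: T (x i).
Proof.
move=> Laff Taff Lx c1.
pose G : set (V * W)%type := [set u | L u.1 /\ T u.1 = u.2].
have Gaff : affine_set G.
  move=> t u v [Lu Tu] [Lv Tv]; split; first exact: Laff.
  by rewrite /= Taff// Tu Tv.
have [|_] := affine_set_combination (x := fun i => (x i, T (x i))) Gaff _ c1.
  by move=> i; split => //=.
have fstE : {morph (fst : V * W -> V) : u v / u + v} by [].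
have sndE : {morph (snd : V * W -> W) : u v / u + v} by [].
by rewrite (big_morph _ fstE erefl) (big_morph _ sndE erefl).
Qed.

Lemma affine_hull_range V n (x : 'I_n -> V) :
  affine_hull (range x) =
  [set v | exists2 c : 'I_n -> R, \sum_(i < n) c i = 1 &
                                  v = \sum_(i < n) c i *: x i].
Proof.
apply/seteqP; split => [|_ [c c1 ->]]; last first.
  apply: affine_set_combination => //; first exact: affine_hull_affine.
  by move=> i; apply: sub_gen_smallest; exists i.
apply: smallest_sub => [t _ _ [a a1 ->] [b b1 ->]|_ [i _ <-]].
  exists (fun i => t * a i + (1 - t) * b i); first exact: sum_mix.
  exact: combination_mix.
by exists (fun j => (j == i)%:R); rewrite ?sum_delta ?sum_delta_scale.
Qed.

Lemma affine_set_convex V (L : set V) : affine_set L -> convex_set L.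
Proof. by move=> Laff u v t /set_mem Lu /set_mem Lv; apply/mem_set/Laff. Qed.

Lemma affine_hull_convex_hull V (A : set V) :
  affine_hull (convex_hull A) = affine_hull A.
Proof.
apply/seteqP; split.
  apply: smallest_sub; first exact: affine_hull_affine.
  rewrite /convex_hull; apply: smallest_sub; last exact: sub_gen_smallest.
  exact: affine_set_convex (affine_hull_affine (A := A)).
apply: sub_smallest2r; first exact: affine_hull_affine.
exact: sub_gen_smallest.
Qed.

Lemma affinely_independent_coords V n (x : 'I_n -> V) (a b : 'I_n -> R) :
  affinely_independent x -> \sum_(i < n) a i = \sum_(i < n) b i ->
  \sum_(i < n) a i *: x i = \sum_(i < n) b i *: x i -> a =1 b.
Proof.
move=> xind ab xab i; apply/eqP; rewrite -subr_eq0; apply/eqP.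
apply: (xind (fun i => a i - b i)); first by rewrite sumrB ab subrr.
by under eq_bigr do rewrite scalerBl; rewrite sumrB xab subrr.
Qed.

Lemma affinely_independent_inj V n (x : 'I_n -> V) :
  affinely_independent x -> injective x.
Proof.
move=> xind i j xij; apply/eqP/negPn/negP => /negPf ij.
have /(_ i) : (fun l => (l == i)%:R : R) =1 (fun l => (l == j)%:R : R).
  apply: (affinely_independent_coords xind); rewrite ?sum_delta//.
  by rewrite !sum_delta_scale.
by rewrite eqxx ij => /eqP; rewrite oner_eq0.
Qed.

End AffineHulls.

(** * Extreme points of simplices *)

Section ExtremePoints.
Context {R : realType}.
Implicit Types V W : lmodType R.

Lemma convex_hull_convex V (A : set V) : convex_set (convex_hull A).
Proof.
move=> u v t /set_mem Au /set_mem Av; apply/mem_set => C [Cconv AC].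
exact: set_mem (Cconv _ _ t (mem_set (Au _ (conj Cconv AC)))
                             (mem_set (Av _ (conj Cconv AC)))).
Qed.

(** Removing an extreme point from a convex set leaves a convex set; so an
    extreme point of the hull outside [A] could be discarded to give a smaller
    convex set containing [A]. *)
Lemma extreme_points_convex_hull V (A : set V) :
  extreme_points (convex_hull A) `<=` A.
Proof.
move=> p [Hp pext]; apply: contrapT => nAp.
suff /(_ p Hp)[_ /(_ erefl)//] : convex_hull A `<=` convex_hull A `\ p.
rewrite {1}/convex_hull; apply: smallest_sub => [|v Av]; last first.
  by split; [exact: sub_gen_smallest|move=> vp; apply: nAp; rewrite -vp].
apply/convex_setW => u v /set_mem[Hu up] /set_mem[Hv vp] t t0 t1.
have Huv := convex_hull_convex t (mem_set Hu) (mem_set Hv).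
apply/mem_set; split; first exact: set_mem Huv.
move=> tuv; have [|//] := pext t%:num u v _ Hu Hv (esym tuv).
by rewrite t0 t1.
Qed.

Lemma convex_hull_range_sub V n (x : 'I_n -> V) :
  convex_hull (range x) `<=`
  [set v | exists c : 'I_n -> R, [/\ forall i, 0 <= c i,
     \sum_(i < n) c i = 1 & v = \sum_(i < n) c i *: x i]].
Proof.
apply: smallest_sub => [u v t|_ [i _ <-]]; last first.
  by exists (fun j => (j == i)%:R); rewrite sum_delta sum_delta_scale.
move=> /set_mem[a [a0 a1 ->]] /set_mem[b [b0 b1 ->]]; apply/mem_set.
exists (fun i => t%:num * a i + (1 - t%:num) * b i); split.
- by move=> i; rewrite addr_ge0// mulr_ge0// subr_ge0.
- exact: sum_mix.
- exact: combination_mix.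
Qed.

(** A vertex has barycentric coordinates [0] except at one index, and a convex
    combination of nonnegative numbers with weights in ]0, 1[ vanishes only if
    these numbers do: both ends of a segment through the vertex have the
    coordinates of the vertex. *)
Lemma extreme_points_simplex V n (x : 'I_n -> V) :
  affinely_independent x -> extreme_points (convex_hull (range x)) = range x.
Proof.
move=> xind; apply/seteqP; split; first exact: extreme_points_convex_hull.
move=> _ [i _ <-]; split; first by apply: sub_gen_smallest; exists i.
move=> t u v /andP[t0 t1] /convex_hull_range_sub[a [a0 a1 ->]].
move=> /convex_hull_range_sub[b [b0 b1 ->]] xi.
have abE : (fun j => (j == i)%:R) =1 (fun j => t * a j + (1 - t) * b j).
  apply: (affinely_independent_coords xind).
    by rewrite sum_delta sum_mix.
  by rewrite sum_delta_scale xi combination_mix.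
have vanish (c : 'I_n -> R) : (forall j, j != i -> c j = 0) ->
    \sum_j c j = 1 -> \sum_j c j *: x j = x i.
  move=> c0 c1; rewrite (bigD1 i)//= big1 => [|j /c0->]; last exact: scale0r.
  move: c1; rewrite (bigD1 i)//= big1 => [|j /c0->//].
  by rewrite !addr0 => ->; rewrite scale1r.
have t'0 : 0 < 1 - t by rewrite subr_gt0.
split; apply: vanish => // j ji; have /esym/eqP := abE j; rewrite (negPf ji).
  rewrite paddr_eq0 ?mulr_ge0 ?(ltW t0) ?(ltW t'0)// => /andP[+ _].
  by rewrite mulf_eq0 gt_eqF//= => /eqP.
rewrite paddr_eq0 ?mulr_ge0 ?(ltW t0) ?(ltW t'0)// => /andP[_].
by rewrite mulf_eq0 gt_eqF//= => /eqP.
Qed.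

Lemma extreme_points_image V W (L : set V) (L' : set W) (T : V -> W) (H : set V) :
  affine_set L -> affine_isomorphism L L' T -> H `<=` L ->
  extreme_points (T @` H) = T @` extreme_points H.
Proof.
move=> Laff [Taff [_ Tinj _]] HL.
have Tinj' u v : L u -> L v -> T u = T v -> u = v.
  by move=> Lu Lv; apply: Tinj; exact/mem_set.
apply/seteqP; split=> [_ [[x Hx <-] xext]|_ [x [Hx xext] <-]].
  exists x => //; split=> // t y z t01 Hy Hz xyz.
  have [|||] := xext t (T y) (T z) t01; first by exists y.
  - by exists z.
  - by rewrite xyz Taff//; exact: HL.
  - by move=> Tyx Tzx; split; apply: Tinj' => //; exact: HL.
split=> [|t _ _ t01 [y Hy <-] [z Hz <-]]; first by exists x.
have [Lx Ly Lz] := And3 (HL _ Hx) (HL _ Hy) (HL _ Hz).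
rewrite -Taff// => /(Tinj' _ _ Lx (Laff _ _ _ Ly Lz)).
by move=> /(xext _ _ _ t01 Hy Hz)[-> ->].
Qed.

Lemma nm_polyhedron_simplex V n (x : 'I_n.+1 -> V) :
  affinely_independent x -> nm_polyhedron n 0 (convex_hull (range x)).
Proof.
move=> xind; split.
- by exists (range x) => //; exact: finite_image.
- by exists x => //; rewrite affine_hull_convex_hull.
- rewrite extreme_points_simplex// addn0 addn1.
  rewrite card_eq_sym; apply: card_eq_trans card_II _; rewrite card_eq_sym.
  by apply: inj_card_eq => i j _ _; exact: affinely_independent_inj xind i j.
Qed.

End ExtremePoints.

(** * Almost isometries between simplices and their perturbation *)

Section Perturbation.
Context {R : realType}.
Implicit Types X Y : normedModType R.

Lemma continuous_sum (T : topologicalType) X (I : Type) (r : seq I)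
    (f : I -> T -> X) :
  (forall i, continuous (f i)) -> continuous (fun t => \sum_(i <- r) f i t).
Proof.
move=> fcont; elim: r => [|i r IHr].
  by under eq_fun do rewrite big_nil; exact: cst_continuous.
under eq_fun do rewrite big_cons.
by move=> t; apply: cvgD; [exact: fcont|exact: IHr].
Qed.

(** Quantitative form of affine independence: the norm of the combination is
    continuous and does not vanish on the compact set of coefficients with sum
    [0] and l1-norm [1], so it is bounded below there; the bound extends to all
    coefficients of sum [0] by homogeneity. *)
Lemma coefficients_bound X n (x : 'I_n -> X) :
  affinely_independent x ->
  exists2 K : R, 0 < K & forall c : 'I_n -> R, \sum_(i < n) c i = 0 ->
    \sum_(i < n) `|c i| <= K * `|\sum_(i < n) c i *: x i|.
Proof.
move=> xind.
pose S : set 'rV[R]_n := [set c | \sum_i c ord0 i = 0 /\ \sum_i `|c ord0 i| = 1].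
pose f (c : 'rV[R]_n) := `|\sum_i c ord0 i *: x i|.
have coordc i : continuous (fun c : 'rV[R]_n => c ord0 i).
  exact: coord_continuous.
have fcont : continuous f.
  have scont : continuous (fun c : 'rV[R]_n => \sum_i c ord0 i *: x i).
    apply: continuous_sum => i c.
    exact: continuousZr_tmp (coordc i c).
  by move=> c; exact: cvg_norm (scont c).
have Sclosed : closed S.
  apply: closedI.
    apply: (closed_comp _ (@closed_eq R 0)) => c _.
    by apply: continuous_sum => i; exact: coordc.
  apply: (closed_comp _ (@closed_eq R 1)) => c _.
  by apply: continuous_sum => i d; exact: cvg_norm (coordc i d).
have cube : compact [set c : 'rV[R]_n | forall i, c ord0 i \in `[-1, 1]].
  apply: (@rV_compact _ _ (fun=> `[(-1 : R), 1]%classic)).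
  by move=> _; exact: segment_compact.
have Scompact : compact S.
  apply: subclosed_compact Sclosed cube _ => c [_ c1] i.
  by rewrite in_itv/= -ler_norml -c1 (bigD1 i)//= lerDl sumr_ge0.
have normalize (c : 'I_n -> R) : \sum_i c i = 0 -> 0 < \sum_i `|c i| ->
    S (\row_i ((\sum_i `|c i|)^-1 * c i)).
  move=> c0 cgt0; split; under eq_bigr do rewrite mxE.
    by rewrite -mulr_sumr c0 mulr0.
  under eq_bigr do rewrite normrM gtr0_norm ?invr_gt0//.
  by rewrite -mulr_sumr mulVf ?gt_eqF.
have sum_ge0 (c : 'I_n -> R) : 0 <= \sum_i `|c i| by rewrite sumr_ge0.
(* With at most one point there is no normalized coefficient vector. *)
have [S0|/set0P S0] := eqVneq S set0.
  exists 1 => // c c0; rewrite mul1r.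
  have := sum_ge0 c; rewrite le_eqVlt => /predU1P[<-//|/(normalize _ c0)].
  by rewrite S0.
have [d /set_mem[d0 d1] dmin] :=
  EVT_min_rV S0 Scompact (continuous_subspaceT fcont).
have fd : 0 < f d.
  rewrite normr_gt0; apply/eqP => /(xind _ d0) dz.
  have : \sum_i `|d ord0 i| = 0 by apply: big1 => i _; rewrite dz normr0.
  by rewrite d1 => /eqP; rewrite oner_eq0.
exists (f d)^-1 => [|c c0]; first by rewrite invr_gt0.
have := sum_ge0 c; rewrite le_eqVlt => /predU1P[<-|cgt0].
  by rewrite mulr_ge0// invr_ge0 ltW.
rewrite ler_pdivlMl// mulrC -ler_pdivlMl//.
have := dmin _ (mem_set (normalize _ c0 cgt0)); rewrite {2}/f.
under eq_bigr do rewrite mxE -scalerA.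
by rewrite -scaler_sumr normrZ gtr0_norm ?invr_gt0.
Qed.

(** A combination of coefficient sum [0] is the difference of two points of the
    affine hull, namely a translate of [x ord0] and [x ord0] itself. *)
Lemma almost_isometric_combination X Y (e : R) (L : set X) (L' : set Y)
    (T : X -> Y) n (x : 'I_n.+1 -> X) (c : 'I_n.+1 -> R) :
  affine_set L -> affine_isomorphism L L' T -> almost_isometric_on e L T ->
  (forall i, L (x i)) -> \sum_i c i = 0 ->
  (1 - e) * `|\sum_i c i *: x i| <= `|\sum_i c i *: T (x i)|
    <= (1 + e) * `|\sum_i c i *: x i|.
Proof.
move=> Laff [Taff _] Tisom Lx c0.
pose a i := (i == ord0)%:R + c i.
have a1 : \sum_i a i = 1 by rewrite big_split/= sum_delta c0 addr0.
have acomb (Z : normedModType R) (z : 'I_n.+1 -> Z) :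
    \sum_i c i *: z i = \sum_i a i *: z i - z ord0.
  under [in RHS]eq_bigr do rewrite scalerDl.
  by rewrite big_split/= sum_delta_scale addrAC subrr add0r.
rewrite !acomb -(affine_map_combination Laff Taff Lx a1).
by apply: Tisom => //; exact: affine_set_combination.
Qed.

(** Moving each vertex by at most [d] moves the combination by at most
    [d * \sum_i `|c i|], which the hypothesis on [K] compares with the norm of
    the original combination. *)
Lemma combination_perturbation X Y (K d : R) n (x : 'I_n -> X)
    (z y : 'I_n -> Y) (c : 'I_n -> R) :
  0 <= d -> (forall i, `|z i - y i| <= d) ->
  \sum_i `|c i| <= K * `|\sum_i c i *: x i| ->
  (1 - d) * `|\sum_i c i *: x i| <= `|\sum_i c i *: z i|
    <= (1 + d) * `|\sum_i c i *: x i| ->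
  (1 - d * (1 + K)) * `|\sum_i c i *: x i| <= `|\sum_i c i *: y i|
    <= (1 + d * (1 + K)) * `|\sum_i c i *: x i|.
Proof.
move=> d0 zy cK /andP[zlo zhi].
have dist : `|\sum_i c i *: z i - \sum_i c i *: y i| <=
    d * (K * `|\sum_i c i *: x i|).
  apply: le_trans (ler_wpM2l d0 cK); rewrite mulr_sumr -sumrB.
  apply: le_trans (ler_norm_sum _ _ _) _; apply: ler_sum => i _.
  by rewrite -scalerBr normrZ mulrC ler_wpM2r.
have := le_trans (lerB_dist _ _) dist.
rewrite distrC in dist; have := le_trans (lerB_dist _ _) dist.
move=> yz zy'; apply/andP; split; lra.
Qed.

Lemma affinely_independent_below X Y (e : R) n (x : 'I_n -> X) (y : 'I_n -> Y) :
  affinely_independent x -> e < 1 ->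
  (forall c : 'I_n -> R, \sum_i c i = 0 ->
    (1 - e) * `|\sum_i c i *: x i| <= `|\sum_i c i *: y i|) ->
  affinely_independent y.
Proof.
move=> xind e1 xy c c0 cy; apply: xind => //; apply/eqP.
have := xy c c0; rewrite cy normr0 pmulr_rle0 ?subr_gt0//.
by rewrite normr_le0.
Qed.

(** [T] maps the point with barycentric coordinates [a] with respect to [x] to
    the point with the same coordinates with respect to [y]; differences of such
    points are combinations of coefficient sum [0]. *)
Lemma almost_isometric_extension X Y (e : R) n (x : 'I_n -> X) (y : 'I_n -> Y) :
  affinely_independent x -> affinely_independent y ->
  (forall c : 'I_n -> R, \sum_i c i = 0 ->
    (1 - e) * `|\sum_i c i *: x i| <= `|\sum_i c i *: y i|
      <= (1 + e) * `|\sum_i c i *: x i|) ->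
  exists T : X -> Y, [/\ forall i, T (x i) = y i,
    affine_isomorphism (affine_hull (range x)) (affine_hull (range y)) T
    & almost_isometric_on e (affine_hull (range x)) T].
Proof.
move=> xind yind xy; rewrite !affine_hull_range.
have /choice[coord coordP] (v : X) : exists c : 'I_n -> R,
    forall a : 'I_n -> R, \sum_i a i = 1 -> v = \sum_i a i *: x i -> c =1 a.
  have [[a [a1 va]]|nv] := pselect (exists a : 'I_n -> R,
    \sum_i a i = 1 /\ v = \sum_i a i *: x i).
    exists a => b b1 vb; apply: (affinely_independent_coords xind).
      by rewrite a1 b1.
    by rewrite -va.
  by exists (fun=> 0) => a a1 va; case: nv; exists a.
pose T v := \sum_i coord v i *: y i.
have TE (a : 'I_n -> R) : \sum_i a i = 1 ->
    T (\sum_i a i *: x i) = \sum_i a i *: y i.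
  by move=> a1; apply: eq_bigr => i _; rewrite (coordP _ _ a1 erefl).
exists T; split.
- by move=> i; rewrite -[x i](sum_delta_scale x) TE ?sum_delta ?sum_delta_scale.
- split=> [t _ _ [a a1 ->] [b b1 ->]|].
    by rewrite combination_mix !TE ?combination_mix// sum_mix.
  split=> [_ [a a1 ->]|u v /set_mem[a a1 ->] /set_mem[b b1 ->]|_ [a a1 ->]].
  + by exists a => //; exact: TE.
  + rewrite !TE// => /(affinely_independent_coords yind) ab.
    by apply: eq_bigr => i _; rewrite ab ?a1 ?b1.
  + by exists (\sum_i a i *: x i); [exists a|exact: TE].
- move=> _ _ [a a1 ->] [b b1 ->]; rewrite !TE// -!sumrB.
  under eq_bigr do rewrite -scalerBl.
  under [X in _ <= `|X| <= _]eq_bigr do rewrite -scalerBl.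
  by apply: xy; rewrite sumrB a1 b1 subrr.
Qed.

End Perturbation.

(** * Nearby points from the Hausdorff distance *)

Section HausdorffDistance.
Context {R : realType}.
Implicit Types Y : normedModType R.

(** Nonemptiness and boundedness ensure that the set of admissible radii is
    nonempty; without them its infimum could be the default value [0], and a
    small distance would say nothing. *)
Lemma hausdorff_distance_lt Y (C D : set Y) (e : R) :
  C !=set0 -> D !=set0 -> bounded_set C -> bounded_set D ->
  hausdorff_distance C D < e ->
  forall c, C c -> exists2 d, D d & `|c - d| < e.
Proof.
move=> C0 D0 [M [_ CM]] [N [_ DN]] CDe.
pose r := (`|M| + 1) + (`|N| + 1).
have r0 : 0 < r by rewrite ltr_wpDr ?ltr_wpDl ?addr_ge0.
have near (E F : set Y) : F !=set0 ->
    (forall u v, E u -> F v -> `|u - v| <= r) ->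
    E `<=` [set d + r *: b | d in F & b in @closed_unit_ball R Y].
  move=> [v Fv] EF u Eu; exists v => //; exists (r^-1 *: (u - v)).
    rewrite /closed_unit_ball/= normrZ gtr0_norm ?invr_gt0//.
    by rewrite ler_pdivrMl ?mulr1 ?EF.
  by rewrite scalerA mulfV ?gt_eqF// scale1r addrC subrK.
have CD u v : C u -> D v -> `|u - v| <= r.
  move=> Cu Dv; apply: le_trans (ler_normB _ _) _.
  have absD1 (t : R) : t < `|t| + 1.
    by rewrite (le_lt_trans (ler_norm _))// ltrDl.
  by apply: lerD; [exact: CM (absD1 M) u Cu|exact: DN (absD1 N) v Dv].
have [|s [s0 Cs _] se c /Cs[d Dd [b b1 <-]]] := inf_lt _ CDe.
  exists r; split=> //; first exact: near.
  by apply: near => // u v Du Cv; rewrite distrC CD.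
exists d => //; rewrite addrAC subrr add0r normrZ gtr0_norm//.
by apply: le_lt_trans se; exact: ler_piMr (ltW s0) b1.
Qed.

End HausdorffDistance.

(** * Strong finite representability implies finite representability *)

Theorem corollary2p7 (R : realType) (X : completeNormedModType R) (A B : set X) :
  strongly_finitely_representable A B -> finitely_representable A B.
Proof.
move=> AB eps eps0 n x xind xA.
have [K K0 xK] := coefficients_bound xind.
(* Any value below [1] would do for [2^-1]: it makes the [y i] affinely
   independent when [eps] is large. *)
pose e := Num.min eps 2^-1.
have e0 : 0 < e by rewrite lt_min eps0 invr_gt0 ltr0n.
have e1 : e < 1 by rewrite gt_min invf_lt1 ?ltr1n ?ltr0n// orbT.
have K10 : 0 < 1 + K by rewrite addr_gt0.
pose d := e / (1 + K).
have d0 : 0 < d by rewrite divr_gt0.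
have dE : d * (1 + K) = e by rewrite divfK// gt_eqF.
have exH := extreme_points_simplex xind.
have [|H' [T [H'poly H'B Tiso Tisom TH']]] :=
  AB d d0 n 0%N _ (nm_polyhedron_simplex xind); first by rewrite exH.
have hullH := affine_hull_convex_hull (range x).
rewrite (extreme_points_image (affine_hull_affine (A := _)) Tiso) in TH';
  last exact: sub_gen_smallest.
rewrite exH in TH'; rewrite hullH in Tiso Tisom.
have [_ _ cardH'] := H'poly.
have /choice[y yP] (i : 'I_n.+1) :
    exists v, extreme_points H' v /\ `|T (x i) - v| < d.
  have [|||||v] := hausdorff_distance_lt _ _ _ _ TH' (c := T (x i)).
  - by exists (T (x i)); exists (x i) => //; exists i.
  - apply/set0P/eqP => H'0; move: cardH'; rewrite H'0 card_eq_sym card_eq0.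
    by rewrite addn0 addn1 => /eqP/seteqP[/(_ 0%N isT)].
  - by apply/compact_bounded/finite_compact; do 2 apply: finite_image.
  - apply/compact_bounded/finite_compact/finite_setP.
    by exists (n + 0 + 1)%N.
  - by exists (x i) => //; exists i.
  - by move=> H'v Txv; exists v.
have xy (c : 'I_n.+1 -> R) : \sum_i c i = 0 ->
    (1 - e) * `|\sum_i c i *: x i| <= `|\sum_i c i *: y i|
      <= (1 + e) * `|\sum_i c i *: x i|.
  move=> c0; rewrite -dE.
  apply: (combination_perturbation (z := T \o x)) (ltW d0) _ (xK c c0) _.
    by move=> i; apply/ltW; case: (yP i).
  apply: almost_isometric_combination _ Tiso Tisom _ c0.
    exact: affine_hull_affine.
  by move=> i; apply: sub_gen_smallest; exists i.
have yind : affinely_independent y.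
  by apply: (affinely_independent_below xind e1) => c /xy/andP[].
have [S [Sx Siso Sisom]] := almost_isometric_extension xind yind xy.
exists y, S; rewrite /= !affine_hull_convex_hull; split=> //.
- by move=> _ [i _ <-]; apply: H'B; case: (yP i).
- by rewrite image_comp; apply: eq_imagel => i _ /=.
- move=> u v Lu Lv; have /andP[lo hi] := Sisom u v Lu Lv.
  have eeps : e <= eps by rewrite ge_min lexx.
  apply/andP; split; [apply: le_trans lo|apply: le_trans hi _];
    by rewrite ler_wpM2r// ?lerD2l ?lerN2.
Qed.
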